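(* Let $A_2$ be the set of the second largest eigenvalues $\lambda_2(G)$ of all simple graphs $G$ without isolated vertices. Then $1/2$ is a limit point of $A_2$.
   Context: All graphs are finite and simple. $\lambda_2(G)$ is the second largest eigenvalue (with multiplicity) of the adjacency matrix of $G$. A limit point of a set of reals is an accumulation point. *)

(* Defs.v *)
From HB Require Import structures.
From mathcomp Require Import all_boot all_order all_algebra.
From mathcomp Require Import all_classical all_reals all_analysis.
Set Implicit Arguments.
Unset Strict Implicit.
Unset Printing Implicit Defensive.
Import Order.TTheory GRing.Theory Num.Theory.
Import numFieldNormedType.Exports.
Local Open Scope classical_set_scope.
Local Open Scope ring_scope.

Record sgraph := SGraph {
  vertex :> finType;
  adj : rel vertex;
  adj_sym : symmetric adj;
  adj_irrefl : irreflexive adj }.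

Definition isolated (G : sgraph) (x : G) : Prop := forall y : G, ~~ adj x y.

Definition adjmx (R : realType) (G : sgraph) : 'M[R]_#|G| :=
  \matrix_(i, j) (adj (enum_val i) (enum_val j))%:R.

(* The eigenvalues of [A], each repeated according to its multiplicity as a
   root of the characteristic polynomial, in nonincreasing order. *)
Definition is_spectrum (R : realType) (n : nat) (A : 'M[R]_n) (s : seq R) :
    Prop :=
  char_poly A = \prod_(x <- s) ('X - x%:P) /\
  sorted (fun x y : R => y <= x) s.

Lemma is_spectrum_uniq (R : realType) (n : nat) (A : 'M[R]_n) (s t : seq R) :
  is_spectrum A s -> is_spectrum A t -> s = t.
Proof.
move=> [As ss] [At st]; apply: (sorted_eq _ _ ss st).
- by move=> y x z /= yx zy; apply: le_trans zy yx.
- by move=> x y /=; rewrite andbC => /le_anti.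
- by apply: prod_XsubC_eq; rewrite -As -At.
Qed.

(* Sequences are indexed from 0; a graph with fewer than two vertices has no
   second largest eigenvalue. *)
Definition is_lambda2 (R : realType) (G : sgraph) (l : R) : Prop :=
  exists s : seq R,
    [/\ is_spectrum (adjmx R G) s, (1 < size s)%N & l = s`_1].

Definition lambda2_set (R : realType) : set R :=
  [set l | exists G : sgraph,
     (forall x : G, ~ isolated x) /\ is_lambda2 G l].

(* Main.v *)
Require Import Defs.
From mathcomp Require Import all_boot all_order all_algebra.
From mathcomp Require Import all_classical all_reals all_analysis.
From mathcomp Require Import ring lra.
Import Order.TTheory GRing.Theory Num.Theory.
Import numFieldNormedType.Exports.
Set Implicit Arguments.
Unset Strict Implicit.
Unset Printing Implicit Defensive.
Local Open Scope classical_set_scope.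
Local Open Scope ring_scope.

(** The join of [n] isolated vertices with [2 K_1 + K_2] has characteristic
    polynomial [X^n (X + 1) (X^3 - X^2 - 4 n X + 2 n)]. The cubic is negative at
    [1/2], and for every [e > 0] it is nonnegative at [1/2 - e] once [n] is
    large; hence its middle root, which is the second largest eigenvalue, tends
    to [1/2] from below as [n] grows. *)

Lemma det_scalar_mx_sub_mulmxC (S : comNzRingType) (N k : nat) (x : S)
    (U : 'M[S]_(N, k)) (V : 'M[S]_(k, N)) :
  x ^+ k * \det (x%:M - U *m V) = x ^+ N * \det (x%:M - V *m U).
Proof.
(* Eliminating either diagonal block of [M] gives one of the two determinants. *)
pose M := block_mx x%:M U V 1%:M.
have -> : \det (x%:M - U *m V) = \det M.
  have : M *m block_mx 1%:M 0 (- V) 1%:M = block_mx (x%:M - U *m V) U 0 1%:M.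
    by rewrite mulmx_block !mulmx1 !mul1mx !mulmxN !mulmx0 !add0r subrr.
  move/(congr1 determinant).
  by rewrite det_mulmx det_lblock det_ublock !det1 !mulr1 => ->.
have : block_mx 1%:M 0 (- V) x%:M *m M
    = block_mx x%:M U 0 (x%:M - V *m U).
  rewrite mulmx_block !mul1mx !mul0mx !mulmx1 !addr0 !mulNmx.
  by rewrite mul_mx_scalar mul_scalar_mx addNr [- _ + _]addrC.
move/(congr1 determinant).
by rewrite det_mulmx det_lblock det_ublock !det_scalar expr1n mul1r.
Qed.

(** The powers of ['X] balance the two sizes. This lets a large matrix of rank at most [k] be
    replaced by a [k]-by-[k] one. *)
Lemma char_poly_mulmxC (S : comNzRingType) (N k : nat)
    (U : 'M[S]_(N, k)) (V : 'M[S]_(k, N)) :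
  'X^k * char_poly (U *m V) = 'X^N * char_poly (V *m U).
Proof.
rewrite /char_poly /char_poly_mx !map_mxM.
exact: det_scalar_mx_sub_mulmxC.
Qed.

Section BlowUp.
Variables (k : nat) (r : rel 'I_k) (m : 'I_k -> nat).
Hypotheses (r_sym : symmetric r) (r_irr : irreflexive r).

Let V : finType := {i : 'I_k & 'I_(m i)}.

Let bl_adj : rel V := fun x y => r (tag x) (tag y).

Let bl_sym : symmetric bl_adj.
Proof. by move=> x y; exact: r_sym. Qed.

Let bl_irr : irreflexive bl_adj.
Proof. by move=> x; exact: r_irr. Qed.

(** Adjacency depends only on the classes, so irreflexivity of [r] makes each class [i] an
    independent set of [m i] vertices. *)
Definition blow_up : sgraph := SGraph bl_sym bl_irr.

Lemma card_blow_up : #|blow_up| = (\sum_i m i)%N.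
Proof.
rewrite card_tagged sumnE big_map big_enum.
by apply: eq_bigr => i _; rewrite card_ord.
Qed.

(** The adjacency matrix factors through the classes as [P *m Q], and [Q *m P] is the quotient
    matrix of the partition into classes. *)
Lemma char_poly_blow_up (R : realType) :
  'X^k * char_poly (adjmx R blow_up) =
  'X^(\sum_i m i) * char_poly (\matrix_(i, j) ((r i j)%:R * (m j)%:R) : 'M[R]_k).
Proof.
pose P : 'M[R]_(#|blow_up|, k) := \matrix_(v, i) (tag (enum_val v) == i)%:R.
pose Q : 'M[R]_(k, #|blow_up|) := \matrix_(i, v) (r i (tag (enum_val v)))%:R.
have -> : adjmx R blow_up = P *m Q.
  apply/matrixP => v w; rewrite !mxE (bigD1 (tag (enum_val v))) //= !mxE eqxx.
  rewrite mul1r big1 ?addr0 // => i; rewrite !mxE eq_sym => /negbTE ->.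
  by rewrite mul0r.
rewrite char_poly_mulmxC -card_blow_up; congr (_ * char_poly _).
apply/matrixP => i j; rewrite !mxE.
under eq_bigr do rewrite !mxE.
rewrite -(big_enum_val (fun x : blow_up => (r i (tag x))%:R * (tag x == j)%:R : R)).
(* Vertices are grouped by class; only class [j] contributes, once for each of its [m j]
   vertices. *)
transitivity (\sum_l \sum_(x < m l) ((r i l)%:R * (l == j)%:R : R)).
  by rewrite sig_big_dep; apply: eq_bigl.
rewrite (bigD1 j) //= [X in _ + X]big1 => [|l /negbTE lj]; last first.
  by rewrite big1 // => x _; rewrite lj mulr0.
by rewrite addr0 sumr_const card_ord eqxx mulr1 mulr_natr.
Qed.

End BlowUp.

(* Class 0 is blown up to the [n] isolated vertices, class 1 to [2 K_1], and
   classes 2 and 3 are the endpoints of [K_2]. *)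
Definition seed_adj : rel 'I_4 := fun i j =>
  (i != j) && [|| i == 0%N :> nat, j == 0%N :> nat | (1 < i)%N && (1 < j)%N].

Lemma seed_adj_sym : symmetric seed_adj.
Proof. by move=> i j; rewrite /seed_adj eq_sym orbCA [in X in [|| _, _ | X]]andbC. Qed.

Lemma seed_adj_irr : irreflexive seed_adj.
Proof. by move=> i; rewrite /seed_adj eqxx. Qed.

Definition seed_weight (n : nat) (i : 'I_4) : nat := nth 0%N [:: n; 2; 1; 1] i.

Definition join_graph (n : nat) : sgraph :=
  blow_up (seed_weight n) seed_adj_sym seed_adj_irr.

(** Vertices of class 0 have a neighbour in class 3; all others have one in class 0, which is
    nonempty because its size is [n.+1]. *)
Lemma join_graph_no_isolated (n : nat) (x : join_graph n.+1) : ~ Defs.isolated x.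
Proof.
have neighbour (i : 'I_4) : exists j, seed_adj i j && (0 < seed_weight n.+1 j)%N.
  have [i0|i_neq0] := eqVneq i ord0.
    by exists ord_max; rewrite i0.
  by exists ord0; rewrite /seed_adj i_neq0 /= orbT.
move=> isox; have [j /andP[xj j_gt0]] := neighbour (tag x).
by have /negP := isox (Tagged (fun i => 'I_(seed_weight n.+1 i)) (Ordinal j_gt0)).
Qed.

Section Spectrum.
Variable R : realType.

Definition join_cubic (n : nat) : {poly R} :=
  'X^3 - 'X^2 - (4 * n%:R) *: 'X + (2 * n%:R)%:P.

Lemma char_poly_join_graph (n : nat) :
  char_poly (adjmx R (join_graph n)) = 'X^n * ('X + 1) * join_cubic n.
Proof.
have nzX4 : 'X^4 != 0 :> {poly R} by rewrite expf_neq0 // polyX_eq0.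
apply: (mulfI nzX4); rewrite char_poly_blow_up.
have -> : (\sum_i seed_weight n i = 4 + n)%N.
  by rewrite !big_ord_recl big_ord0 /= addnC.
rewrite exprD -[LHS]mulrA; congr (_ * _); rewrite -[RHS]mulrA; congr (_ * _).
rewrite /char_poly.
(* Three Laplace expansions reduce the 4-by-4 determinant to 1-by-1 minors. *)
do 3! rewrite ?(expand_det_row _ ord0) ?big_ord_recl ?big_ord0 /cofactor.
rewrite /= !det_mx11 !mxE /= /seed_weight /bump /= /join_cubic -mul_polyC.
rewrite !(mul0r, mul1r, mulr0n, mulr1n, polyC0, rmorphM, rmorph_nat) /=.
ring.
Qed.

Lemma horner_join_cubic (n : nat) (x : R) :
  (join_cubic n).[x] = x ^+ 3 - x ^+ 2 - 4 * n%:R * x + 2 * n%:R.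
Proof. by rewrite !hornerE. Qed.

(** The cubic changes sign on each of the intervals from [- (4 * N + 1)] to [-1], from [1 / 2 - e]
    to [1 / 2], and from [1 / 2] to [4 * N + 1], which gives three roots. *)
Lemma join_cubic_factor (n : nat) (e : R) :
  (0 < n)%N -> 0 < e -> e < 1 / 2 -> 1 <= 4 * n%:R * e ->
  exists a b c : R,
    [/\ 1 / 2 < a, 1 / 2 - e <= b < 1 / 2, c < -1 &
        join_cubic n = ('X - a%:P) * ('X - b%:P) * ('X - c%:P)].
Proof.
rewrite -(ler1n R) => n_ge1 e_gt0 e_lt ne_ge1.
set N : R := n%:R in n_ge1 ne_ge1.
(* The terms in [N] cancel at [1 / 2], leaving [- 1 / 8]. *)
have half_lt0 : (join_cubic n).[1 / 2] < 0.
  by rewrite horner_join_cubic -/N; lra.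
have [c c_itv rc] : exists2 c, - (4 * N + 1) <= c <= -1 & root (join_cubic n) c.
  by apply: poly_ivt; rewrite ?horner_join_cubic -/N; [lra|apply/andP; split; nra].
have [b b_itv rb] : exists2 b, 1 / 2 - e <= b <= 1 / 2 & root (- join_cubic n) b.
  apply: poly_ivt; first by lra.
  rewrite !hornerN oppr_le0 oppr_ge0 (ltW half_lt0) andbT horner_join_cubic -/N.
  nra.
have [a a_itv ra] : exists2 a, 1 / 2 <= a <= 4 * N + 1 & root (join_cubic n) a.
  apply: poly_ivt; first by lra.
  by rewrite (ltW half_lt0) /= horner_join_cubic -/N; nra.
rewrite rootN in rb.
(* This makes the bounds at [1 / 2] strict, so that [a] and [b] are distinct. *)
have neq_half x : root (join_cubic n) x -> x != 1 / 2.
  by move=> rx; apply: contraTneq rx => ->; rewrite rootE lt_eqF.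
have a_gt : 1 / 2 < a by rewrite lt_neqAle eq_sym neq_half //; case/andP: a_itv.
have b_lt : b < 1 / 2 by rewrite lt_neqAle neq_half //; case/andP: b_itv.
have c_lt : c < -1.
  rewrite lt_neqAle; case/andP: c_itv => _ ->; rewrite andbT.
  apply: contraTneq rc => ->; rewrite rootE horner_join_cubic -/N.
  by rewrite gt_eqF //; lra.
exists a, b, c; split=> //; first by case/andP: b_itv => ->.
(* The coefficient list gives both the degree and the leading coefficient 1. *)
have seqE : join_cubic n = [:: 2 * N; - (4 * N); -1; 1] :> seq R.
  suff -> : join_cubic n = Poly [:: 2 * N; - (4 * N); -1; 1].
    by apply: (@PolyK _ 0); exact: oner_neq0.
  rewrite /= !cons_poly_def mul0r /join_cubic -/N -mul_polyC !polyCN; ring.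
have -> : join_cubic n = lead_coef (join_cubic n) *: \prod_(z <- [:: a; b; c]) ('X - z%:P).
  apply: all_roots_prod_XsubC; last 2 first.
  - by rewrite /= ra rb rc.
  - rewrite uniq_rootsE /= !inE negb_or.
    by rewrite !gt_eqF //; [case/andP: b_itv|..]; lra.
  by rewrite seqE.
by rewrite lead_coefE seqE /= scale1r !big_cons big_nil mulr1 mulrA.
Qed.

(** The remaining eigenvalues, 0 with multiplicity [n] and -1, lie between [c] and [b], so [b] has
    index 1 in the sorted list. *)
Lemma is_lambda2_join_graph (n : nat) (a b c : R) :
  0 < b -> b < a -> c < -1 ->
  join_cubic n = ('X - a%:P) * ('X - b%:P) * ('X - c%:P) ->
  is_lambda2 (join_graph n) b.
Proof.
move=> b_gt0 ba c_lt jE.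
exists (a :: b :: nseq n 0 ++ [:: -1; c]); split=> //; split.
  rewrite char_poly_join_graph jE !big_cons big_cat !big_cons big_nil /= mulr1.
  rewrite big_nseq subr0 iter_mulr_1 polyCN opprK.
  by ring.
rewrite /= (ltW ba) /=.
case: n {jE} => [|n] /=; first by rewrite (ltW c_lt) andbT; lra.
rewrite (ltW b_gt0) /= cat_path /=.
have -> : last (0 : R) (nseq n 0) = 0 by elim: n.
rewrite (ltW c_lt) lerN10 !andbT.
by elim: n => //= n ->; rewrite lexx.
Qed.

End Spectrum.

Theorem mainTheorem2 (R : realType) : limit_point (@lambda2_set R) (1 / 2).
Proof.
move=> U /nbhs_ballP[d /= d_gt0 dU].
(* The bound [d / 2] puts [b] inside the ball; [1 / 4] keeps [1 / 2 - e] positive, hence [b] too. *)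
pose e := Num.min (d / 2) (1 / 4).
have e_gt0 : 0 < e by rewrite lt_min; apply/andP; split; lra.
have e_lt : e < 1 / 2 by rewrite gt_min; apply/orP; right; lra.
have e_ltd : e < d by rewrite gt_min; apply/orP; left; lra.
have einv_ge0 : 0 <= e^-1 by rewrite invr_ge0 ltW.
pose n := Num.bound e^-1.
have ne_ge1 : 1 <= 4 * n.+1%:R * e.
  have : e^-1 < n%:R := archi_boundP einv_ge0.
  rewrite -(ltr_pM2r e_gt0) mulVf ?gt_eqF // -natr1 => ?.
  by nra.
have [a [b [c [a_gt /andP[b_ge b_lt] c_lt jE]]]] :=
  join_cubic_factor (ltn0Sn n) e_gt0 e_lt ne_ge1.
exists b; split; first by rewrite lt_eqF.
- exists (join_graph n.+1); split; first exact: join_graph_no_isolated.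
  by apply: (is_lambda2_join_graph _ _ _ jE) => //; lra.
- apply: dU; rewrite -ball_normE /=.
  by rewrite ger0_norm; lra.
Qed.
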